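(* Let $(G,\alpha)$ be a Hom-group, let $H$ be a Hom-normal subgroup of $G$, and let $G/H$ be the set of all (left) Hom-cosets $aH$, $a\in G$, of $H$ in $G$. Then $G/H$ is a Hom-group under the binary operation given by $\widetilde{\mu}(aH,bH)=(ab)H$, with the twisting map $\widetilde{\alpha}(aH)=\alpha(a)H$.
   Context: A Hom-group $(G,\alpha)$ is a set $G$ together with a distinguished element $1\in G$ (the unit), a bijective map $\alpha:G\to G$ and a binary operation $G\times G\to G$, $(g,h)\mapsto gh$, such that for all $g,h,k\in G$: (1) $\alpha(g)(hk)=(gh)\alpha(k)$; (2) $\alpha(gh)=\alpha(g)\alpha(h)$; (3) $g1=1g=\alpha(g)$; (4) there exists $g^{-1}\in G$ with $gg^{-1}=g^{-1}g=1$. A Hom-subgroup of a Hom-group $(G,\alpha)$ is a nonempty subset $H\subseteq G$ closed under the product of $G$ such that $(H,\alpha)$ (with $\alpha$ restricted to a bijection $H\to H$) is itself a Hom-group under the product of $G$. For $a\in G$, the left and right Hom-cosets are $aH=\{ah\mid h\in H\}$ and $Ha=\{ha\mid h\in H\}$. A Hom-subgroup $H$ of $G$ is a Hom-normal subgroup if $gH=Hg$ for every $g\in G$. The claim includes that $\widetilde{\mu}$ and $\widetilde{\alpha}$ are well defined. *)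

(* Defs.v *)
From mathcomp Require Import all_boot.
From mathcomp Require Import boolp classical_sets.

Set Implicit Arguments.
Unset Strict Implicit.
Unset Printing Implicit Defensive.

Local Open Scope classical_set_scope.

Record is_hom_group (T : Type) (one : T) (alpha : T -> T) (mul : T -> T -> T)
    : Prop := IsHomGroup {
  hom_group_bij : bijective alpha;
  hom_group_assoc : forall g h k,
    mul (alpha g) (mul h k) = mul (mul g h) (alpha k);
  hom_group_morph : forall g h, alpha (mul g h) = mul (alpha g) (alpha h);
  hom_group_unit : forall g, mul g one = alpha g /\ mul one g = alpha g;
  hom_group_inv : forall g, exists g', mul g g' = one /\ mul g' g = one
}.

(* The structure on H lives on the subtype {x | x \in H}: its product and
   twisting map are the restrictions of those of G, while its unit is only
   required to be some element of H. *)
Record is_hom_subgroup (G : Type) (alpha : G -> G) (mul : G -> G -> G)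
    (H : set G) : Prop := IsHomSubgroup {
  hom_subgroup_nonempty : H !=set0;
  hom_subgroup_closed : forall x y, H x -> H y -> H (mul x y);
  hom_subgroup_hom_group :
    exists (oneH : H) (alphaH : H -> H) (mulH : H -> H -> H),
      [/\ forall x : H, val (alphaH x) = alpha (val x),
          forall x y : H, val (mulH x y) = mul (val x) (val y)
        & is_hom_group oneH alphaH mulH]
}.

Definition hom_lcoset (G : Type) (mul : G -> G -> G) (H : set G) (a : G)
  : set G := [set mul a h | h in H].

Definition hom_rcoset (G : Type) (mul : G -> G -> G) (H : set G) (a : G)
  : set G := [set mul h a | h in H].

Record is_hom_normal (G : Type) (alpha : G -> G) (mul : G -> G -> G)
    (H : set G) : Prop := IsHomNormal {
  hom_normal_subgroup : is_hom_subgroup alpha mul H;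
  hom_normal_cosets : forall g, hom_lcoset mul H g = hom_rcoset mul H g
}.

Definition hom_quotient (G : Type) (mul : G -> G -> G) (H : set G) : Type :=
  set_type (range (hom_lcoset mul H)).

Definition hom_coset_class (G : Type) (mul : G -> G -> G) (H : set G) (a : G)
  : hom_quotient mul H :=
  exist _ (hom_lcoset mul H a) (mem_set (imageT (hom_lcoset mul H) a)).

(* Main.v *)
Require Import Defs.
From mathcomp Require Import all_boot.
From mathcomp Require Import boolp classical_sets.

(** A Hom-group is an ordinary group in disguise: undoing the twist in
    [g * h := alpha^-1 (g h)] yields a group with the same unit, of which
    [alpha] is an automorphism, and the Hom-product is recovered as
    [alpha (g * h)].  Hom-associativity is exactly associativity of [*], and
    the only point of the dictionary that is not immediate is that [alpha]
    fixes the unit ([twist_one]).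

    Through this dictionary a Hom-subgroup [H] is an [alpha]-stable subgroup
    of this group, and the Hom-coset [aH] is [alpha (a * H)].  Hence [aH = a'H]
    iff [a' = a * h] for some [h] in [H] ([hom_lcoset_eqP]), and
    Hom-normality is ordinary normality ([untwist_normal]).  That the product
    and the twisting map pass to cosets is then the usual computation
    [(a * h) * (b * k) = (a * b) * (h' * k)], together with the stability of
    [H] under [alpha].  The axioms on the quotient are inherited from [G]
    because every element of the quotient is the class of an element of [G];
    the only point that is not formal is the injectivity of the induced
    twisting map, which holds because [alpha^-1] also preserves [H]. *)

(** * The group underlying a Hom-group *)

Section Untwist.

Set Implicit Arguments.
Unset Strict Implicit.

Context (G : Type) (one : G) (alpha ainv : G -> G) (mul : G -> G -> G).
Hypothesis hG : is_hom_group one alpha mul.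
Hypotheses (alphaK : cancel alpha ainv) (ainvK : cancel ainv alpha).

Definition untwist (g h : G) : G := ainv (mul g h).

Lemma twist_untwist g h : alpha (untwist g h) = mul g h.
Proof. exact: ainvK. Qed.

(** Every [y] is some [alpha x], so [y (alpha 1) = alpha (x 1) = alpha y].
    For [y = 1] this gives [1 (alpha 1) = alpha 1], whereas the unit axiom
    gives [1 (alpha 1) = alpha (alpha 1)]; injectivity of [alpha] concludes. *)
Lemma twist_one : alpha one = one.
Proof.
have mul_twist_one y : mul y (alpha one) = alpha y.
  rewrite -[y]ainvK -(hom_group_morph hG).
  by rewrite (hom_group_unit hG (ainv y)).1.
apply: (can_inj alphaK).
by rewrite -[LHS](hom_group_unit hG (alpha one)).2 mul_twist_one.
Qed.

Lemma untwistA g h k : untwist g (untwist h k) = untwist (untwist g h) k.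
Proof.
rewrite /untwist; congr ainv; apply: (can_inj alphaK).
by rewrite !(hom_group_morph hG) !ainvK (hom_group_assoc hG).
Qed.

Lemma untwistg1 g : untwist g one = g.
Proof. by rewrite /untwist (hom_group_unit hG g).1 alphaK. Qed.

Lemma untwist1g g : untwist one g = g.
Proof. by rewrite /untwist (hom_group_unit hG g).2 alphaK. Qed.

Lemma twist_morph g h : alpha (untwist g h) = untwist (alpha g) (alpha h).
Proof. by rewrite twist_untwist /untwist -(hom_group_morph hG) alphaK. Qed.

Lemma ainv_one : ainv one = one.
Proof. by rewrite -{1}twist_one alphaK. Qed.

Lemma untwist_inv g :
  exists g', untwist g g' = one /\ untwist g' g = one.
Proof.
have [g' [gg' g'g]] := hom_group_inv hG g; exists g'.
by rewrite /untwist gg' g'g ainv_one.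
Qed.

Lemma ainv_morph g h : ainv (untwist g h) = untwist (ainv g) (ainv h).
Proof.
by apply: (can_inj alphaK); rewrite ainvK twist_morph !ainvK.
Qed.

(** * Hom-subgroups and Hom-cosets in the untwisted group *)

Section Subgroup.

Context (H : set G).
Hypothesis hH : is_hom_subgroup alpha mul H.

Lemma twist_subgroup x : H x -> H (alpha x).
Proof.
move=> Hx; have [oneH [alphaH [mulH [valA _ _]]]] := hom_subgroup_hom_group hH.
by have := valA (exist _ x (mem_set Hx)); rewrite /= => <-; apply: set_valP.
Qed.

Lemma ainv_subgroup x : H x -> H (ainv x).
Proof.
move=> Hx; have [oneH [alphaH [mulH [valA _ hHG]]]] := hom_subgroup_hom_group hH.
have [binv _ binvK] := hom_group_bij hHG.
have /= := valA (binv (exist _ x (mem_set Hx))).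
by rewrite binvK /= => ->; rewrite alphaK; apply: set_valP.
Qed.

Lemma untwist_subgroup x y : H x -> H y -> H (untwist x y).
Proof. by move=> Hx Hy; apply: ainv_subgroup; apply: (hom_subgroup_closed hH). Qed.

(** The unit of [H] is idempotent in a group, hence trivial: a Hom-subgroup
    cannot have a unit of its own. *)
Lemma subgroup_unit (oneH : H) (alphaH : H -> H) (mulH : H -> H -> H) :
    (forall x, val (alphaH x) = alpha (val x)) ->
    (forall x y, val (mulH x y) = mul (val x) (val y)) ->
  is_hom_group oneH alphaH mulH -> val oneH = one.
Proof.
move=> valA valM hHG; set e := val oneH.
have ee : untwist e e = e.
  by rewrite /untwist -valM (hom_group_unit hHG oneH).1 valA alphaK.
have [e' [_ e'e]] := untwist_inv e.
by rewrite -[e]untwist1g -e'e -untwistA ee.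
Qed.

Lemma one_subgroup : H one.
Proof.
have [oneH [alphaH [mulH [valA valM hHG]]]] := hom_subgroup_hom_group hH.
by rewrite -(subgroup_unit valA valM hHG); apply: set_valP.
Qed.

Lemma inv_subgroup x : H x -> exists2 y, H y & untwist x y = one.
Proof.
move=> Hx; have [oneH [alphaH [mulH [valA valM hHG]]]] :=
  hom_subgroup_hom_group hH.
have [y [xy _]] := hom_group_inv hHG (exist _ x (mem_set Hx)).
exists (val y); first exact: set_valP.
have := valM (exist _ x (mem_set Hx)) y.
by rewrite xy (subgroup_unit valA valM hHG) /untwist /= => <-; apply: ainv_one.
Qed.

Lemma hom_lcoset_untwist_sub a h :
  H h -> (hom_lcoset mul H (untwist a h) `<=` hom_lcoset mul H a)%classic.
Proof.
move=> Hh _ [k Hk <-]; exists (untwist h k); first exact: untwist_subgroup.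
by rewrite -!twist_untwist untwistA.
Qed.

(** The Hom-coset [aH] need not contain [a], only [alpha a = a 1]; membership
    of [alpha a'] in [aH] is what determines [a'] as [a * h]. *)
Lemma hom_lcoset_eqP a a' :
  hom_lcoset mul H a = hom_lcoset mul H a' <->
  exists2 h, H h & a' = untwist a h.
Proof.
split=> [eq_aa' | [h Hh ->]].
  have: hom_lcoset mul H a' (mul a' one) by exists one => //; apply: one_subgroup.
  rewrite -eq_aa' => -[h Hh ah]; exists h => //.
  by rewrite /untwist ah (hom_group_unit hG a').1 alphaK.
apply/seteqP; split; last exact: hom_lcoset_untwist_sub.
have [k Hk hk] := inv_subgroup Hh.
by rewrite -{1}[a]untwistg1 -hk untwistA; apply: hom_lcoset_untwist_sub.
Qed.

(** One direction makes the twisting map of the quotient well defined, because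
    [alpha] preserves [H]; the other makes it injective, because [alpha^-1]
    does. *)
Lemma hom_lcoset_twist a a' :
  hom_lcoset mul H (alpha a) = hom_lcoset mul H (alpha a') <->
  hom_lcoset mul H a = hom_lcoset mul H a'.
Proof.
rewrite !hom_lcoset_eqP; split=> -[h Hh eq_a'].
  exists (ainv h); first exact: ainv_subgroup.
  by rewrite -[a']alphaK eq_a' ainv_morph alphaK.
by exists (alpha h); [apply: twist_subgroup | rewrite eq_a' twist_morph].
Qed.

End Subgroup.

(** Hom-cosets on either side are the [alpha]-images of the cosets in the
    untwisted group, so cancelling [alpha] leaves ordinary normality. *)
Lemma untwist_normal (H : set G) g h :
    is_hom_normal alpha mul H -> H h ->
  exists2 h', H h' & untwist h g = untwist g h'.
Proof.
move=> hH Hh; have: hom_rcoset mul H g (mul h g) by exists h.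
rewrite -(hom_normal_cosets hH) => -[h' Hh' gh'].
by exists h' => //; rewrite /untwist gh'.
Qed.

Lemma hom_lcoset_mul (H : set G) a a' b b' :
    is_hom_normal alpha mul H ->
    hom_lcoset mul H a = hom_lcoset mul H a' ->
    hom_lcoset mul H b = hom_lcoset mul H b' ->
  hom_lcoset mul H (mul a b) = hom_lcoset mul H (mul a' b').
Proof.
move=> hH; have sH := hom_normal_subgroup hH.
move=> /(hom_lcoset_eqP sH)[h Hh ->] /(hom_lcoset_eqP sH)[k Hk ->].
have [h' Hh' hb] := untwist_normal b hH Hh.
rewrite -!twist_untwist; apply/(hom_lcoset_twist sH)/(hom_lcoset_eqP sH).
exists (untwist h' k); first exact: untwist_subgroup.
by rewrite -!untwistA (untwistA h) hb -!untwistA.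
Qed.

End Untwist.

(** * The quotient *)

Lemma hom_coset_class_eqP (G : Type) (mul : G -> G -> G) (H : set G) (a a' : G) :
  hom_coset_class mul H a = hom_coset_class mul H a' <->
  hom_lcoset mul H a = hom_lcoset mul H a'.
Proof. by split=> [/(congr1 val) | eq_aa'] //; apply: val_inj. Qed.

Lemma hom_coset_class_surj (G : Type) (mul : G -> G -> G) (H : set G)
    (q : hom_quotient mul H) :
  exists a, q = hom_coset_class mul H a.
Proof.
have [a _ aq] := set_valP q.
by exists a; apply: val_inj.
Qed.

Theorem proposition4p6 (G : Type) (one : G) (alpha : G -> G)
    (mul : G -> G -> G) (H : set G)
    (hG : is_hom_group one alpha mul)
    (hH : is_hom_normal alpha mul H) :
  (forall a a' b b' : G,
      hom_lcoset mul H a = hom_lcoset mul H a' ->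
      hom_lcoset mul H b = hom_lcoset mul H b' ->
      hom_lcoset mul H (mul a b) = hom_lcoset mul H (mul a' b')) /\
  (forall a a' : G,
      hom_lcoset mul H a = hom_lcoset mul H a' ->
      hom_lcoset mul H (alpha a) = hom_lcoset mul H (alpha a')) /\
  (exists (mut : hom_quotient mul H -> hom_quotient mul H -> hom_quotient mul H)
          (alphat : hom_quotient mul H -> hom_quotient mul H)
          (onet : hom_quotient mul H),
      (forall a b : G,
          mut (hom_coset_class mul H a) (hom_coset_class mul H b)
          = hom_coset_class mul H (mul a b)) /\
      (forall a : G,
          alphat (hom_coset_class mul H a) = hom_coset_class mul H (alpha a)) /\
      is_hom_group onet alphat mut).
Proof.
have [ainv alphaK ainvK] := hom_group_bij hG.
have sH := hom_normal_subgroup hH.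
have mul_wd a a' b b' := @hom_lcoset_mul _ _ _ _ _ hG alphaK ainvK H a a' b b' hH.
have twist_wd := hom_lcoset_twist hG alphaK ainvK sH.
split=> [//|]; split=> [a a' /twist_wd //|].
pose cl := hom_coset_class mul H.
have clP a a' : cl a = cl a' <-> hom_lcoset mul H a = hom_lcoset mul H a'.
  exact: hom_coset_class_eqP.
have [rep repK] := choice (@hom_coset_class_surj G mul H).
have rep_cl a : hom_lcoset mul H (rep (cl a)) = hom_lcoset mul H a.
  by apply/clP; rewrite /cl -repK.
pose mut q r := cl (mul (rep q) (rep r)); pose alphat q := cl (alpha (rep q)).
have mutE a b : mut (cl a) (cl b) = cl (mul a b).
  by apply/clP/mul_wd; apply: rep_cl.
have alphatE a : alphat (cl a) = cl (alpha a).
  by apply/clP/twist_wd; apply: rep_cl.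
have clW (P : hom_quotient mul H -> Prop) : (forall a, P (cl a)) -> forall q, P q.
  by move=> Pcl q; rewrite (repK q); apply: Pcl.
exists mut, alphat, (cl one); split=> //; split=> //; split.
- exists (fun q => cl (ainv (rep q))); apply: (clW) => a.
    rewrite alphatE; apply/clP/twist_wd; rewrite ainvK; exact: rep_cl.
  by rewrite alphatE ainvK; apply/clP/rep_cl.
- apply: (clW) => a; apply: (clW) => b; apply: (clW) => c.
  by rewrite !(alphatE, mutE) (hom_group_assoc hG).
- apply: (clW) => a; apply: (clW) => b.
  by rewrite !(alphatE, mutE) (hom_group_morph hG).
- apply: (clW) => a; rewrite !(alphatE, mutE).
  by have [-> ->] := hom_group_unit hG a.
- apply: (clW) => a; have [a' [aa' a'a]] := hom_group_inv hG a.
  by exists (cl a'); rewrite !mutE aa' a'a.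
Qed.
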